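(* Fix an integer $k\ge2$, and for each $n\ge1$ define \[ \mathcal{I}_n=\{I\cap[n-1] : \varnothing\subsetneq I\subsetneq\mathbb{P}\text{ and } I \text{ is } \ell\text{-periodic for some } \ell \text{ with } 1\le\ell\le k\}. \] Then \[ \lim_{n\to\infty}\ \max_{I\in\mathcal{I}_n}\left|\frac{n\,\beta^{\mathrm{cyc}}_n(I)}{\beta_n(I)}-1\right| = 0. \]
   Context: $[n]=\{1,\dots,n\}$ and $\mathbb{P}$ is the set of positive integers. For an integer $\ell\ge1$, a set $I\subseteq\mathbb{P}$ is $\ell$-periodic if for each $i\in\mathbb{P}$ we have $i\in I$ if and only if $i+\ell\in I$. $S_n$ is the symmetric group on $[n]$ and $C_n\subseteq S_n$ is the set of permutations consisting of a single cycle of length $n$. The descent set of $\pi\in S_n$ is $D(\pi)=\{i\in[n-1]:\pi(i)>\pi(i+1)\}$. For $I\subseteq[n-1]$, $\beta_n(I)=\#\{\pi\in S_n: D(\pi)=I\}$ and $\beta^{\mathrm{cyc}}_n(I)=\#\{\pi\in C_n: D(\pi)=I\}$. *)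

(* Defs.v *)
From HB Require Import structures.
From mathcomp Require Import all_boot all_order all_algebra all_fingroup.
From mathcomp Require Import all_classical all_reals all_analysis.
Set Implicit Arguments.
Unset Strict Implicit.
Unset Printing Implicit Defensive.

Import Order.TTheory GRing.Theory Num.Theory.
Import numFieldNormedType.Exports.

Local Open Scope classical_set_scope.
Local Open Scope nat_scope.

(* The integer interval [m] = {1, ..., m} is encoded by 'I_m, the ordinal a   *)
(* standing for the integer a.+1.  Thus permutations of [n] are elements of   *)
(* 'S_n and subsets of [n-1] are elements of {set 'I_n.-1}.  Infinite sets of *)
(* positive integers are sets of naturals (not shifted) avoiding 0.           *)

Definition posints : set nat := [set i | 0 < i].

Definition ell_periodic (l : nat) (I : set nat) : Prop :=
  forall i, 0 < i -> (I i <-> I (i + l)).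

(* The positions p = a.+1 and p.+1 of [n] are the ordinals i, j of values a   *)
(* and a.+1.                                                                  *)
Definition descent_set (n : nat) (s : 'S_n) : {set 'I_n.-1} :=
  [set a : 'I_n.-1 | [exists i : 'I_n, exists j : 'I_n,
     [&& i == a :> nat, j == a.+1 :> nat & s j < s i]]]%SET.

Definition is_full_cycle (n : nat) (s : 'S_n) : bool :=
  porbits s == [set [set: 'I_n]]%SET.

Definition beta (n : nat) (I : {set 'I_n.-1}) : nat :=
  #|[set s : 'S_n | descent_set s == I]%SET|.

Definition beta_cyc (n : nat) (I : {set 'I_n.-1}) : nat :=
  #|[set s : 'S_n | is_full_cycle s & descent_set s == I]%SET|.

Definition trace (n : nat) (I : set nat) : {set 'I_n.-1} :=
  [set a : 'I_n.-1 | `[< I a.+1 >]]%SET.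

Definition periodic_traces (k n : nat) : {set {set 'I_n.-1}} :=
  [set A : {set 'I_n.-1} | `[< exists I : set nat,
     [/\ set0 `<` I, I `<` posints,
         exists l, 1 <= l <= k /\ ell_periodic l I
       & A = trace n I] >]]%SET.

(* The iterated maximum starts at 0; this is the maximum over the family,     *)
(* because the terms are nonnegative and, for k >= 2, the family is nonempty. *)
Definition max_deviation (R : realType) (k n : nat) : R :=
  (\big[Num.max/0]_(I in periodic_traces k n)
     `|n%:R * (beta_cyc I)%:R / (beta I)%:R - 1|)%R.

(* Main.v *)
Require Import Defs.
From HB Require Import structures.
From mathcomp Require Import all_boot all_order all_algebra all_fingroup.
From mathcomp Require Import all_classical all_reals all_analysis.
From mathcomp Require Import zify.
Set Implicit Arguments.
Unset Strict Implicit.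
Unset Printing Implicit Defensive.

Import Order.TTheory GRing.Theory Num.Theory.
Import numFieldNormedType.Exports.

(** Fix a set [J] of allowed descents. It cuts the positions into blocks, and a
    permutation has its descents in [J] exactly when it increases on every
    block. Both kinds of permutations to be compared are coded by words in the
    block labels.

    - If [s] increases on the blocks, the word recording the block of
      [s^-1 i] determines [s], and every rearrangement of the sequence of
      labels occurs (standardization, [card_block_increasing]).
    - If [s] is moreover an [n]-cycle with a chosen base point [x], the word
      recording the blocks of [x], [s x], [s^2 x], ... determines the pair: a
      point is smaller than another as soon as its itinerary is
      lexicographically smaller, so the cyclic order and the ranks of the
      rotations of the word rebuild [s]. The words that occur are the
      rearrangements with pairwise distinct rotations (a special case of the
      Gessel-Reutenauer bijection: [pointed_cycles_key], [card_words_le]).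

    So [n] times the number of [n]-cycles with descents in [J] differs from
    the number of all permutations with descents in [J] by at most the number
    of words fixed by a nontrivial rotation. Such a word is constant on the
    orbits of a fixed-point-free permutation, hence there are at most
    [n * n ^ (n / 2)] of them. Inclusion-exclusion over the subsets of [I]
    turns this into [|n beta_cyc(I) - beta(I)| <= 2 ^ n * n * n ^ (n / 2)]
    ([beta_cyc_error]), for every [I].

    For periodic [I] with both descents and ascents, [beta(I)] is much larger.
    All runs are shorter than [k], so the position [p] can be given one of
    [2 k] levels in such a way that consecutive levels compare as the descent
    set demands ([level_function]). A permutation that gives the smallest values
    to the lowest level, the next values to the next level, and so on, has
    descent set [I]; these permutations are a proportion of at least
    [(2 k) ^ - n] of all permutations ([fact_le_beta_periodic]). As
    [n ^ n <= 4 ^ n * n`!], the quotient of the two bounds is at most [C / n]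
    with [C] depending only on [k], for [n >= C] ([max_deviation_le]). *)

(** * Orders, ranks and rearrangements *)

(** Both functions list the same multiset of labels in sorted order. *)
Lemma monotone_rearrangement n N (b : 'I_n -> 'I_N) (t : 'S_n) :
  {homo b : i j / i <= j} -> {homo b \o t : i j / i <= j} -> b \o t =1 b.
Proof.
move=> bh th.
have sortedP (f : 'I_n -> 'I_N) : {homo f : i j / i <= j} ->
    sorted leq [seq val (f i) | i <- enum 'I_n].
  move=> fh; rewrite sorted_map; apply: (@sub_sorted _ (relpre val leq)).
    by move=> i j; apply: fh.
  by rewrite -sorted_map val_enum_ord iota_sorted.
have enum_t : perm_eq (map t (enum 'I_n)) (enum 'I_n).
  apply: uniq_perm; rewrite ?(map_inj_uniq perm_inj) ?enum_uniq // => i.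
  by rewrite mem_enum -[i](permKV t) map_f ?mem_enum.
have /eq_in_map eq_b : [seq val (b (t i)) | i <- enum 'I_n] = [seq val (b i) | i <- enum 'I_n].
  apply: (sorted_eq leq_trans anti_leq); [exact: sortedP th | exact: sortedP bh |].
  by rewrite (map_comp (fun i : 'I_n => val (b i)) t) perm_map.
by move=> i; apply/val_inj/eq_b; rewrite mem_enum.
Qed.

Lemma exists_rank_perm n (key : 'I_n -> nat) : injective key ->
  exists rho : 'S_n, forall i j, (rho i < rho j) = (key i < key j).
Proof.
move=> key_inj.
pose below i := [set j | key j < key i].
have below_lt i : #|below i| < n.
  rewrite -[X in _ < X]card_ord -cardsT; apply: proper_card; apply/properP.
  by split; [apply/fintype.subsetP | exists i; rewrite !inE ?ltnn].
pose f i := Ordinal (below_lt i).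
have f_mono i j : (f i < f j) = (key i < key j).
  have [lt_ij|] := ltnP (key i) (key j).
    apply: proper_card; apply/properP; split.
      by apply/fintype.subsetP => l; rewrite !inE => /ltn_trans; apply.
    by exists i; rewrite !inE ?ltnn.
  move=> le_ji; apply/negbTE; rewrite -leqNgt; apply: subset_leq_card.
  by apply/fintype.subsetP => l; rewrite !inE => /leq_trans; apply.
have f_inj : injective f.
  move=> i j eq_f; apply: key_inj; apply/eqP; rewrite eqn_leq.
  have := f_mono i j; have := f_mono j i; rewrite eq_f ltnn.
  by move=> /esym/negbT + /esym/negbT; rewrite -!leqNgt => -> ->.
by exists (perm f_inj) => i j; rewrite !permE.
Qed.

(** The value of a permutation at [i] is the rank of [i] in the order that the
    permutation induces. *)
Lemma perm_eq_of_order n (rho sigma : 'S_n) :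
  (forall i j, (rho i < rho j) = (sigma i < sigma j)) -> rho = sigma.
Proof.
move=> same; apply/permP => i.
have mono : {homo id \o (rho^-1 * sigma)%g : j l / (j : 'I_n) <= l}.
  by move=> j l jl /=; rewrite !permM leqNgt -same !permKV -leqNgt.
have := monotone_rearrangement (b := id) (fun _ _ => id) mono (rho i).
by rewrite /= permM permK => ->.
Qed.

(** Sorting the positions in a way that sorts the labels puts the labels where
    the monotone function [b] has them. *)
Lemma rank_word n N (b : 'I_n -> 'I_N) (s rho : 'S_n) :
    {homo b : i j / i <= j} ->
    (forall i j, rho i < rho j -> b (s i) <= b (s j)) ->
  forall i, b (rho i) = b (s i).
Proof.
move=> bh sh i.
have mono : {homo b \o (rho^-1 * s)%g : j l / j <= l}.
  move=> j l; rewrite /= !permM leq_eqVlt => /orP[/eqP/val_inj-> // | jl].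
  by apply: sh; rewrite !permKV.
by rewrite -(monotone_rearrangement bh mono) /= permM permK.
Qed.

Lemma digits_ltE B a a' r r' : r < B -> r' < B ->
  (a * B + r < a' * B + r') = (a < a') || (a == a') && (r < r').
Proof.
move=> rB r'B; case: (ltngtP a a') => [lt_a|lt_a|->] /=; last by rewrite ltn_add2l.
- by have : a.+1 * B <= a' * B by [rewrite leq_mul2r lt_a orbT]; rewrite mulSn; lia.
- by have : a'.+1 * B <= a * B by [rewrite leq_mul2r lt_a orbT]; rewrite mulSn; lia.
Qed.

(** * Itineraries *)

(** The labels met along [x], [f x], [f (f x)], ... are read as the digits of a
    number in base [N], most significant digit first, so that comparing numbers
    is comparing itineraries lexicographically. *)
Fixpoint itinerary (T : Type) (f : T -> T) N (w : T -> 'I_N) (m : nat) (x : T) : nat :=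
  if m is m'.+1 then w x * N ^ m' + itinerary f w m' (f x) else 0.

Lemma itinerary_bound T (f : T -> T) N (w : T -> 'I_N) m x :
  itinerary f w m x < N ^ m.
Proof.
elim: m x => [|m IH] x //=; have := IH (f x); have := ltn_ord (w x).
rewrite expnS => lt_w lt_i.
have : (w x).+1 * N ^ m <= N * N ^ m by rewrite leq_mul2r lt_w orbT.
rewrite mulSn; lia.
Qed.

Lemma itinerary_ltE T (f : T -> T) N (w : T -> 'I_N) m x y :
  (itinerary f w m.+1 x < itinerary f w m.+1 y) =
  (w x < w y) || (w x == w y) && (itinerary f w m (f x) < itinerary f w m (f y)).
Proof. by rewrite /= digits_ltE ?itinerary_bound. Qed.

Lemma itinerary_inj T (f : T -> T) N (w : T -> 'I_N) m x y :
  itinerary f w m x = itinerary f w m y ->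
  forall t, t < m -> w (iter t f x) = w (iter t f y).
Proof.
elim: m x y => [|m IH] x y // eq_it.
have := itinerary_ltE f w m x y; have := itinerary_ltE f w m y x.
rewrite eq_it ltnn => /esym/negbT/norP[+ n2] /esym/negbT/norP[+ n4].
rewrite -!leqNgt => le1 le2.
have eq_w : w x = w y by apply/val_inj/eqP; rewrite eqn_leq le1 le2.
move: n2 n4; rewrite eq_w eqxx /= -!leqNgt => le3 le4.
case=> [|t] lt_t //; rewrite !iterSr; apply: IH => //.
by apply/eqP; rewrite eqn_leq le3 le4.
Qed.

(** A comparison decided within [m] digits is not affected by one more digit. This
    restores the full length after the first digit has been dropped. *)
Lemma itinerary_widen T (f : T -> T) N (w : T -> 'I_N) m x y :
  itinerary f w m x < itinerary f w m y ->
  itinerary f w m.+1 x < itinerary f w m.+1 y.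
Proof.
elim: m x y => [|m IH] x y //; rewrite itinerary_ltE => /orP[lt_w | /andP[/eqP eq_w lt_i]].
  by rewrite itinerary_ltE lt_w.
by rewrite itinerary_ltE eq_w eqxx IH ?orbT.
Qed.

(** * Words of labels and standardization *)

Definition word n N (b : 'I_n -> 'I_N) (s : 'S_n) : {ffun 'I_n -> 'I_N} :=
  [ffun i => b (s i)].

Definition words n N (b : 'I_n -> 'I_N) : {set {ffun 'I_n -> 'I_N}} :=
  [set word b s | s in [set: 'S_n]].

Definition block_increasing n N (b : 'I_n -> 'I_N) : {set 'S_n} :=
  [set s : 'S_n | [forall i : 'I_n, forall j : 'I_n, (i < j) && (b i == b j) ==> (s i < s j)]].

Lemma block_increasingP n N (b : 'I_n -> 'I_N) (s : 'S_n) :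
  reflect (forall i j : 'I_n, i < j -> b i = b j -> s i < s j) (s \in block_increasing b).
Proof.
rewrite inE; apply: (iffP forallP) => [inc i j ij bij | inc i].
  by have /forallP/(_ j)/implyP := inc i; apply; rewrite ij bij eqxx.
by apply/forallP => j; apply/implyP => /andP[ij /eqP]; apply: inc.
Qed.

(** A permutation whose induced order can be read off its word is determined by
    that word. Both codings, by standardization and by itineraries, are injective
    for this reason; they differ in the [key] alone. *)
Lemma word_inj_in n N (b : 'I_n -> 'I_N) (key : {ffun 'I_n -> 'I_N} -> 'I_n -> nat)
    (X : {set 'S_n}) :
    {in X, forall (rho : 'S_n) (i j : 'I_n),
       (rho i < rho j) = (key (word b rho) i < key (word b rho) j)} ->
  {in X &, injective (word b)}.
Proof.
move=> keyX rho sigma Xr Xs eq_w; apply: perm_eq_of_order => i j.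
by rewrite (keyX rho) // (keyX sigma) // eq_w.
Qed.

(** The converse of the previous lemma: ranking the positions of a word by [key]
    produces a permutation with that word. *)
Lemma standardization n N (b : 'I_n -> 'I_N) (key : 'I_n -> nat) w :
    {homo b : i j / i <= j} -> w \in words b -> injective key ->
    (forall i j, key i < key j -> w i <= w j) ->
  exists2 rho : 'S_n, word b rho = w & forall i j, (rho i < rho j) = (key i < key j).
Proof.
move=> bh /imsetP[s _ ->{w}] key_inj key_mono.
have [rho rhoE] := exists_rank_perm key_inj; exists rho => //.
apply/ffunP => i; rewrite !ffunE; apply: rank_word => // j l; rewrite rhoE.
by move=> /key_mono; rewrite !ffunE.
Qed.

Lemma label_position_inj n N (w : 'I_n -> 'I_N) :
  injective (fun i : 'I_n => w i * n + i).
Proof.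
move=> i j /(congr1 (modn^~ n)) eq_k; apply/val_inj.
by move: eq_k; rewrite !modnMDl !modn_small.
Qed.

(** Here ties between equal labels are broken by the position: a permutation
    increasing on the blocks is recovered from the word of its inverse by sorting
    the pairs (label, position). *)
Lemma card_block_increasing n N (b : 'I_n -> 'I_N) :
  {homo b : i j / i <= j} -> #|block_increasing b| = #|words b|.
Proof.
move=> bh; pose key (w : {ffun 'I_n -> 'I_N}) (i : 'I_n) := w i * n + i.
pose X := [set rho : 'S_n | (rho^-1)%g \in block_increasing b].
have keyX : {in X, forall (rho : 'S_n) (i j : 'I_n),
    (rho i < rho j) = (key (word b rho) i < key (word b rho) j)}.
  move=> rho; rewrite inE => /block_increasingP inc i j.
  rewrite digits_ltE // !ffunE.
  have [lt_r|lt_r|/val_inj/perm_inj->] := ltngtP (rho i) (rho j).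
  - have := bh _ _ (ltnW lt_r); rewrite leq_eqVlt => /orP[/eqP eq_b|->//].
    by have := inc _ _ lt_r (val_inj eq_b); rewrite !permK eq_b eqxx ltnn /= => ->.
  - have := bh _ _ (ltnW lt_r); rewrite leq_eqVlt => /orP[/eqP eq_b|lt_b].
      have := inc _ _ lt_r (val_inj eq_b); rewrite !permK eq_b eqxx ltnn /=.
      by move=> lt_ji; rewrite ltnNge (ltnW lt_ji).
    by rewrite ltnNge (ltnW lt_b) gtn_eqF.
  - by rewrite !ltnn andbF.
have <- : #|X| = #|block_increasing b|.
  by rewrite -(card_preimset (block_increasing b) (@invg_inj _)).
rewrite -(card_in_imset (word_inj_in keyX)).
suff -> : words b = [set word b rho | rho in X] by [].
apply/eqP; rewrite finset.eqEsubset; apply/andP; split; last first.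
  by apply: imsetS; apply: finset.subsetT.
apply/fintype.subsetP => w Ww.
have key_inj : injective (key w) by exact: label_position_inj.
have [i j|rho <- rhoE] := standardization bh Ww key_inj.
  by rewrite digits_ltE // => /orP[/ltnW//|/andP[/eqP->]].
apply/imsetP; exists rho => //; rewrite inE; apply/block_increasingP => u v uv eq_b.
have : rho (rho^-1 u)%g < rho (rho^-1 v)%g by rewrite !permKV.
by rewrite rhoE digits_ltE // !ffunE !permKV eq_b ltnn eqxx.
Qed.

(** * Words fixed by a rotation *)

Definition rotation n : 'S_n := perm (@ordS_inj n).

Lemma rotationX n t (i : 'I_n) : (rotation n ^+ t)%g i = (i + t) %% n :> nat.
Proof.
elim: t => [|t IH]; first by rewrite perm1 addn0 modn_small.
by rewrite expgSr permM permE /= IH addnS -[in LHS]addn1 -[in RHS]addn1 modnDml.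
Qed.

Lemma rotation_trans n (i j : 'I_n) : exists2 t, t < n & j = (rotation n ^+ t)%g i.
Proof.
have n_gt0 : 0 < n by apply: leq_ltn_trans (ltn_ord i).
exists ((j + (n - i)) %% n); first by rewrite ltn_mod.
apply: val_inj; rewrite /= rotationX modnDmr addnCA subnKC; last exact: ltnW.
by rewrite modnDr modn_small.
Qed.

(** A fixed word is constant on the orbits of [tau], so it is determined by its
    letters at the least points of the orbits. The image by [tau] of the set of
    these points is disjoint from it, because no orbit is a singleton; so there
    are at most [n / 2] of them. *)
Lemma card_fixed_words n N (tau : 'S_n) : 0 < N -> (forall i, tau i != i) ->
  #|[set w : {ffun 'I_n -> 'I_N} | [forall i, w (tau i) == w i]]| <= N ^ n./2.
Proof.
move=> N_gt0 tau_fpf.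
pose R := [set x : 'I_n | [forall y in porbit tau x, x <= y]].
have R_small : #|R| <= n./2.
  have disj : [disjoint R & tau @: R].
    apply/pred0P => y /=; apply/negP => /andP[Ry /imsetP[x Rx y_def]].
    move: Ry Rx; rewrite !inE => /forall_inP/(_ x) yx /forall_inP/(_ y) xy.
    have xy_orb : y \in porbit tau x by rewrite y_def (mem_porbit _ 1).
    have /eqP := tau_fpf x; rewrite -y_def; apply; apply/val_inj/eqP.
    by rewrite eqn_leq yx ?xy // porbit_sym.
  rewrite geq_half_double -addnn -{2}(card_imset _ (@perm_inj _ tau)) -cardsUI.
  by rewrite (disjoint_setI0 disj) cards0 addn0 -[X in _ <= X]card_ord max_card.
have S0 : #|{ffun {x | x \in R} -> 'I_N}| <= N ^ n./2.
  by rewrite card_ffun card_ord card_sig leq_pexp2l // (leq_trans _ R_small).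
apply: leq_trans S0.
pose restrict (w : {ffun 'I_n -> 'I_N}) := [ffun x : {x | x \in R} => w (val x)].
rewrite -(card_in_imset (f := restrict)) ?max_card //.
move=> w w'; rewrite !inE => /forallP wP /forallP w'P /ffunP eq_r.
have const (v : {ffun 'I_n -> 'I_N}) x y : (forall i, v (tau i) == v i) ->
    y \in porbit tau x -> v y = v x.
  move=> vP /porbitP[t ->]; elim: t => [|t IH]; first by rewrite perm1.
  by rewrite expgSr permM (eqP (vP _)).
apply/ffunP => x.
have [y yx ymin] : exists2 y, y \in porbit tau x & forall z, z \in porbit tau x -> y <= z.
  by case: (arg_minnP (fun y : 'I_n => y : nat) (porbit_id tau x)) => y; exists y.
have Ry : y \in R.
  rewrite inE; apply/forall_inP => z zy; apply: ymin.
  by move: yx zy; rewrite -!eq_porbit_mem => /eqP-> /eqP->.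
by rewrite -(const w x y) // -(const w' x y) //; have := eq_r (Sub y Ry); rewrite !ffunE.
Qed.

Lemma rotationD n s t (i : 'I_n) :
  (rotation n ^+ s)%g ((rotation n ^+ t)%g i) = (rotation n ^+ (t + s))%g i.
Proof. by rewrite expgnDr permM. Qed.

Lemma rotation_order n : (rotation n ^+ n = 1)%g.
Proof.
apply/permP => i; apply: val_inj.
by rewrite /= rotationX perm1 modnDr modn_small.
Qed.

Lemma card_periodic_words n N : 0 < N ->
  #|[set w : {ffun 'I_n -> 'I_N} | [exists d : 'I_n, (0 < d) &&
     [forall i, w ((rotation n ^+ d)%g i) == w i]]]| <= n * N ^ n./2.
Proof.
move=> N_gt0.
pose F (d : 'I_n) := if 0 < d then
  [set w : {ffun 'I_n -> 'I_N} | [forall i, w ((rotation n ^+ d)%g i) == w i]]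
  else finset.set0.
have F_small d : #|F d| <= N ^ n./2.
  rewrite /F; case: ifP => [d_gt0|_]; last by rewrite cards0.
  apply: card_fixed_words => // i; apply/eqP => /(congr1 (@nat_of_ord n)).
  rewrite rotationX; have := ltn_ord i; have := ltn_ord d.
  move=> lt_d lt_i; have [le_n|lt_n] := leqP n (i + d); last by rewrite modn_small //; lia.
  by rewrite -(subnK le_n) modnDr modn_small; lia.
apply: leq_trans (_ : #|\bigcup_d F d| <= _).
  apply: subset_leq_card; apply/fintype.subsetP => w; rewrite inE.
  case/existsP => d /andP[d_gt0 wP]; apply/finset.bigcupP; exists d => //.
  by rewrite /F d_gt0 inE.
apply: leq_trans (_ : \sum_d #|F d| <= _).
  elim/big_rec2: _ => [|d S m _ le_S]; first by rewrite cards0.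
  by rewrite (leq_trans (leq_card_setU _ _).1) // leq_add2l.
by rewrite -[n in n * _]card_ord -sum_nat_const leq_sum.
Qed.

(** If the itineraries of [i] and [j = i + d] agree over a full turn, then every
    letter agrees with the letter [d] places further. *)
Lemma nonprimitive_periodic n N (w : {ffun 'I_n -> 'I_N}) (i j : 'I_n) :
    i != j -> itinerary (rotation n) w n i = itinerary (rotation n) w n j ->
  exists2 d : 'I_n, 0 < d & forall x, w ((rotation n ^+ d)%g x) = w x.
Proof.
move=> ij eq_it; have eq_w t : t < n -> w ((rotation n ^+ t)%g i) = w ((rotation n ^+ t)%g j).
  by move=> lt_t; rewrite !permX; apply: (itinerary_inj eq_it).
have [d lt_d j_def] := rotation_trans i j.
exists (Ordinal lt_d) => [|x] /=.
  by case: d j_def {lt_d} => // j_def; rewrite j_def perm1 eqxx in ij.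
have [t lt_t ->] := rotation_trans i x.
by rewrite rotationD [RHS]eq_w // j_def rotationD addnC.
Qed.

(** * Cyclic permutations with a base point *)

(** A permutation [rho] stands for the [n]-cycle [rho 0 -> rho 1 -> ...] with base
    point [rho 0]; this cycle is the conjugate of the rotation by [rho]. *)
Definition pointed_cycles n N (b : 'I_n -> 'I_N) : {set 'S_n} :=
  [set rho : 'S_n | (rotation n ^ rho)%g \in block_increasing b].

Lemma pointed_cyclesP n N (b : 'I_n -> 'I_N) (rho : 'S_n) :
  reflect (forall i j : 'I_n, rho i < rho j -> b (rho i) = b (rho j) ->
             rho (rotation n i) < rho (rotation n j))
          (rho \in pointed_cycles b).
Proof.
rewrite inE; apply: (iffP (block_increasingP _ _)) => [inc i j lt_r eq_b | inc u v].
  by have := inc _ _ lt_r eq_b; rewrite !permJ.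
rewrite -[u](permKV rho) -[v](permKV rho) => lt_r eq_b; rewrite !permJ.
exact: inc.
Qed.

(** Suppose that [i] and [j = i + d] have the same itinerary, with
    [rho i < rho j]. As the cycle increases on the blocks, the inequality
    persists along the orbits, and the points [rho i], [rho (i + d)],
    [rho (i + 2 d)], ... increase forever, which is absurd in a finite set. *)
Lemma pointed_cycles_primitive n N (b : 'I_n -> 'I_N) rho :
  rho \in pointed_cycles b -> injective (itinerary (rotation n) (word b rho) n).
Proof.
move/pointed_cyclesP => inc i j eq_it; apply/eqP/contraT => ij.
wlog lt_r : i j eq_it ij / rho i < rho j.
  move=> gen; have [|lt_r|/val_inj/perm_inj eq_ij] := ltngtP (rho i) (rho j).
  - exact: gen.
  - by apply: (gen j i) => //; rewrite eq_sym.
  - by rewrite eq_ij eqxx in ij.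
have [d _ j_def] := rotation_trans i j.
have up t : rho ((rotation n ^+ t)%g i) < rho ((rotation n ^+ t)%g j).
  elim: t => [|t IH]; first by rewrite !perm1.
  rewrite !expgSr !permM; apply: inc => //.
  have lt_t : t %% n < n by rewrite ltn_mod (leq_ltn_trans _ (ltn_ord i)).
  have := itinerary_inj eq_it lt_t; rewrite !ffunE => eq_b.
  by rewrite -(expg_mod t (rotation_order n)) !permX.
have far s : s <= rho ((rotation n ^+ (s * d))%g i).
  elim: s => // s IH; apply: leq_ltn_trans IH _; apply: leq_trans (up _) _.
  by rewrite j_def rotationD mulSn.
by have := far n; rewrite leqNgt ltn_ord.
Qed.

(** A smaller point has a smaller itinerary: labels are monotone, and while they
    agree the cycle preserves the order of the two points. *)
Lemma pointed_cycles_key n N (b : 'I_n -> 'I_N) rho : {homo b : i j / i <= j} ->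
    rho \in pointed_cycles b ->
  forall i j, (rho i < rho j) = (itinerary (rotation n) (word b rho) n i <
                                 itinerary (rotation n) (word b rho) n j).
Proof.
move=> bh Yr i j.
have mono m u v : rho u < rho v ->
    itinerary (rotation n) (word b rho) m u <= itinerary (rotation n) (word b rho) m v.
  elim: m u v => // m IH u v lt_r; rewrite leqNgt itinerary_ltE !ffunE.
  have := bh _ _ (ltnW lt_r); rewrite leq_eqVlt => /orP[/eqP/val_inj eq_b|lt_b].
    rewrite eq_b ltnn eqxx /= -leqNgt; apply: IH.
    by move/pointed_cyclesP: Yr => inc; apply: inc.
  by rewrite -(inj_eq val_inj) /= ltnNge (ltnW lt_b) gtn_eqF.
have [lt_r|lt_r|/val_inj/perm_inj->] := ltngtP (rho i) (rho j).
- apply/esym; rewrite ltn_neqAle mono // andbT; apply/eqP.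
  by move/(pointed_cycles_primitive Yr) => eq_ij; rewrite eq_ij ltnn in lt_r.
- by apply/esym/negbTE; rewrite -leqNgt mono.
- by rewrite ltnn.
Qed.

Lemma card_pointed_cycles_le n N (b : 'I_n -> 'I_N) :
  {homo b : i j / i <= j} -> #|pointed_cycles b| <= #|words b|.
Proof.
move=> bh; rewrite -(card_in_imset (f := word b) (D := pointed_cycles b)).
  by apply/subset_leq_card/imsetS/finset.subsetT.
apply: (@word_inj_in _ _ _ (fun w => itinerary (rotation n) w n)) => rho Yr i j.
exact: pointed_cycles_key.
Qed.

(** A word with distinct rotations is reached by ranking its rotations: the
    resulting cycle moves the rank of a rotation to the rank of the next one, and
    dropping an equal first letter from two words does not change their order. *)
Lemma card_words_le n N (b : 'I_n -> 'I_N) : 0 < N ->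
  {homo b : i j / i <= j} -> #|words b| <= #|pointed_cycles b| + n * N ^ n./2.
Proof.
move=> N_gt0 bh.
apply: leq_trans (leq_add (leq_imset_card (word b) _) (card_periodic_words n N_gt0)).
apply: leq_trans (leq_card_setU _ _).1.
apply/subset_leq_card/fintype.subsetP => w Ww; rewrite finset.in_setU orbC.
rewrite -implyNb; apply/implyP => aper.
have key_inj : injective (itinerary (rotation n) w n).
  move=> i j eq_it; apply/eqP; apply: contraNT aper => ij; rewrite inE.
  have [d d_gt0 wP] := nonprimitive_periodic ij eq_it.
  by apply/existsP; exists d; rewrite d_gt0; apply/forallP => x; rewrite wP.
have n_pred (i : 'I_n) : n = n.-1.+1 by rewrite prednK // (leq_ltn_trans _ (ltn_ord i)).
have step (i j : 'I_n) : itinerary (rotation n) w n i < itinerary (rotation n) w n j ->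
    (w i < w j) || (w i == w j) &&
    (itinerary (rotation n) w n.-1 (rotation n i) <
     itinerary (rotation n) w n.-1 (rotation n j)).
  by rewrite [X in itinerary _ _ X i](n_pred i) [X in itinerary _ _ X j](n_pred i) itinerary_ltE.
have [i j /step|rho w_def rhoE] := standardization bh Ww key_inj.
  by case/orP => [/ltnW//|/andP[/eqP->]].
apply/imsetP; exists rho => //.
have bE x : b (rho x) = w x by rewrite -w_def ffunE.
apply/pointed_cyclesP => i j; rewrite !rhoE !bE => /step.
move=> + eq_w; rewrite eq_w ltnn eqxx /= => lt_i.
by have := itinerary_widen lt_i; rewrite -(n_pred i).
Qed.

Lemma full_cycleP n (s : 'S_n) : 0 < n ->
  reflect (forall x y, y \in porbit s x) (is_full_cycle s).
Proof.
move=> n_gt0; apply: (iffP eqP) => [full x y | trans].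
  have : porbit s x \in porbits s by apply: imset_f.
  by rewrite full inE => /eqP->; rewrite inE.
have orbT x : porbit s x = [set: 'I_n] by apply/setP => y; rewrite trans inE.
apply/setP => A; rewrite !inE; apply/imsetP/eqP => [[x _ ->] // | ->].
by exists (Ordinal n_gt0).
Qed.

Lemma rotation_conj_full n (rho : 'S_n) : 0 < n -> is_full_cycle (rotation n ^ rho)%g.
Proof.
move=> n_gt0; apply/full_cycleP => // x y.
have [t _ y_def] := rotation_trans (rho^-1%g x) (rho^-1%g y).
apply/porbitP; exists t; rewrite -conjXg -[x](permKV rho) permJ -y_def.
by rewrite permKV.
Qed.

(** The permutation [rho] is [i |-> s^i x], which is injective because the orbit
    of [x] has [n] elements. *)
Lemma full_cycle_conj n (s : 'S_n) (x : 'I_n) (n_gt0 : 0 < n) : is_full_cycle s ->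
  exists2 rho : 'S_n, (rotation n ^ rho)%g = s & rho (Ordinal n_gt0) = x.
Proof.
move=> /(full_cycleP _ n_gt0) trans.
have orb_n : #|porbit s x| = n.
  by rewrite -[RHS]card_ord; apply: eq_card => y; rewrite trans.
have f_inj : injective (fun i : 'I_n => (s ^+ i)%g x).
  move=> i j; rewrite !permX => eq_i; apply/val_inj/eqP => /=.
  have := uniq_traject_porbit s x; rewrite orb_n => /(nth_uniq x) <-; rewrite ?size_traject //.
  by rewrite !nth_traject // eq_i.
exists (perm f_inj); last by rewrite permE perm1.
apply/permP => y; rewrite -[y](permKV (perm f_inj)) permJ.
move: (_ y) => i; rewrite !permE -permM -expgSr /=.
have [lt_i|] := ltnP i.+1 n; first by rewrite modn_small.
have := ltn_ord i; rewrite leq_eqVlt ltnNge => /orP[/eqP eq_i _|]; last by move/negPf->.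
by rewrite eq_i modnn perm1 permX -[X in iter X]orb_n iter_porbit.
Qed.

(** Each [n]-cycle arises from [n] permutations [rho], one for each choice of the
    base point [rho 0]. *)
Lemma card_conj_rotation n (P : {set 'S_n}) : 0 < n ->
  #|[set rho : 'S_n | (rotation n ^ rho)%g \in P]| =
  n * #|[set s in P | is_full_cycle s]|.
Proof.
move=> n_gt0; pose o := Ordinal n_gt0.
pose f (rho : 'S_n) := (rho o, (rotation n ^ rho)%g).
have f_inj : injective f.
  move=> rho sigma [eq_o eq_c]; apply/permP => i.
  have [t _ ->] := rotation_trans o i.
  have jE (r : 'S_n) : r ((rotation n ^+ t)%g o) = ((rotation n ^ r) ^+ t)%g (r o).
    by rewrite -conjXg permJ.
  by rewrite !jE eq_o eq_c.
transitivity (#|[set: 'I_n]| * #|[set s in P | is_full_cycle s]|); last first.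
  by rewrite cardsT card_ord.
rewrite -cardsX -(card_imset _ f_inj).
apply: eq_card => -[x s]; rewrite !inE /=; apply/imsetP/andP => [[rho] | [Ps full]].
  by rewrite inE => Pr [_ ->]; rewrite Pr rotation_conj_full.
have [rho def_s def_x] := full_cycle_conj x n_gt0 full.
by exists rho; rewrite ?inE /f ?def_s ?def_x.
Qed.

(** * Descent sets as blocks *)

Lemma block_index_subproof n (J : {set 'I_n.-1}) (u : 'I_n) :
  #|[set a in J | a < u]| < n.
Proof.
apply: leq_ltn_trans (max_card _) _; rewrite card_ord prednK //.
exact: leq_ltn_trans (ltn_ord u).
Qed.

(** The number of the block of [u], counted from the left. *)
Definition block_index n (J : {set 'I_n.-1}) (u : 'I_n) : 'I_n :=
  Ordinal (block_index_subproof J u).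

Lemma block_index_mono n (J : {set 'I_n.-1}) : {homo block_index J : u v / u <= v}.
Proof.
move=> u v uv; apply/subset_leq_card/fintype.subsetP => a.
by rewrite !inE => /andP[-> /leq_trans]; apply.
Qed.

Lemma block_index_lt n (J : {set 'I_n.-1}) (a : 'I_n.-1) (u v : 'I_n) :
  a \in J -> u <= a -> a < v -> block_index J u < block_index J v.
Proof.
move=> Ja ua av; apply: proper_card; apply/properP; split.
  apply/fintype.subsetP => c; rewrite !inE => /andP[-> cu].
  by rewrite (leq_trans cu) // (leq_trans ua) // ltnW.
by exists a; rewrite !inE Ja // -leqNgt.
Qed.

Lemma block_index_gap n (J : {set 'I_n.-1}) (a : 'I_n.-1) (u v : 'I_n) :
  a \notin J -> u = a :> nat -> v = a.+1 :> nat -> block_index J u = block_index J v.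
Proof.
move=> nJa ua va; apply: val_inj; apply: eq_card => c; rewrite !inE ua va ltnS.
rewrite [c <= a]leq_eqVlt; have [eq_ca|//] := eqVneq (c : nat) a.
by rewrite (val_inj eq_ca) (negPf nJa).
Qed.

Lemma mem_descent_set n (s : 'S_n) (a : 'I_n.-1) (i j : 'I_n) :
  i = a :> nat -> j = a.+1 :> nat -> (a \in descent_set s) = (s j < s i).
Proof.
move=> ia ja; rewrite inE; apply/existsP/idP => [[i'] | lt_s].
  case/existsP=> j' /and3P[/eqP i'a /eqP j'a].
  have <- : i' = i by apply: val_inj; rewrite /= i'a ia.
  by have <- : j' = j by apply: val_inj; rewrite /= j'a ja.
by exists i; apply/existsP; exists j; rewrite ia ja lt_s !eqxx.
Qed.

Lemma descent_position n (a : 'I_n.-1) :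
  exists i j : 'I_n, i = a :> nat /\ j = a.+1 :> nat.
Proof.
have lt_a : a.+1 < n by have := ltn_ord a; lia.
by exists (Ordinal (ltnW lt_a)), (Ordinal lt_a).
Qed.

Lemma descent_subset_blocks n (s : 'S_n) (J : {set 'I_n.-1}) :
  (descent_set s \subset J) = (s \in block_increasing (block_index J)).
Proof.
apply/fintype.subsetP/block_increasingP => [sub u v uv | inc a].
  (* It suffices to compare neighbours, since a label that is equal at the two
     ends of an interval is constant on it. *)
  have step (i j : 'I_n) : j = i.+1 :> nat -> block_index J i = block_index J j -> s i < s j.
    move=> ji eq_b; have lt_i : i < n.-1 by have := ltn_ord j; rewrite ji; lia.
    pose a : 'I_n.-1 := Ordinal lt_i.
    have nJa : a \notin J.
      apply/negP => Ja; have := @block_index_lt _ _ a i j Ja (leqnn i).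
      by rewrite eq_b ltnn ji ltnSn => /(_ isT).
    have := contra (sub a) nJa; rewrite (mem_descent_set s (erefl : i = a :> nat) ji).
    rewrite -leqNgt leq_eqVlt => /orP[/eqP/val_inj/perm_inj eq_ij|//].
    by move: ji; rewrite eq_ij; lia.
  have [d v_def] : exists d, v = u + d.+1 :> nat.
    by exists (v - u.+1); rewrite addnS -addSn subnKC.
  elim: d v v_def {uv} => [|d IH] v v_def eq_b; first by apply: step; rewrite ?v_def ?addn1.
  have lt_w : u + d.+1 < n by have := ltn_ord v; rewrite v_def; lia.
  pose w := Ordinal lt_w.
  have le1 : block_index J u <= block_index J w by apply: block_index_mono; apply: leq_addr.
  have le2 : block_index J w <= block_index J v.
    by apply: block_index_mono; rewrite v_def /= [_ + d.+2]addnS.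
  have eq1 : block_index J u = block_index J w.
    by apply: ord_inj; apply: anti_leq; rewrite le1 eq_b le2.
  apply: ltn_trans (IH w erefl eq1) _; apply: step; first by rewrite v_def /= addnS.
  by rewrite -eq1.
have [i [j [ia ja]]] := descent_position a.
rewrite (mem_descent_set _ ia ja); apply: contraLR => nJa.
rewrite -leqNgt ltnW //; apply: inc; first by rewrite ia ja.
exact: block_index_gap nJa ia ja.
Qed.

Lemma count_by_descent_set n (P : pred 'S_n) (J : {set 'I_n.-1}) :
  #|[set s | P s & descent_set s \subset J]| =
  \sum_(D : {set 'I_n.-1} | D \subset J) #|[set s | P s & descent_set s == D]|.
Proof.
rewrite -sum1_card (partition_big (@descent_set n)
  (fun D : {set 'I_n.-1} => D \subset J)) /=; last first.
  by move=> s; rewrite inE => /andP[].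
apply: eq_bigr => D DJ; rewrite -sum1_card; apply: eq_bigl => s; rewrite !inE -andbA.
by congr (_ && _); have [->|] := eqVneq (descent_set s) D; rewrite ?DJ // andbF.
Qed.

(** * From containment to equality of descent sets *)

Local Open Scope ring_scope.

(** Inclusion-exclusion, with one factor [2] for each element [x] of [A]: the sum
    over the sets that contain [x] is the sum without a condition on [x] minus the
    sum over the sets that avoid [x]. The induction goes through sums
    over intervals [A <= D <= B]. *)
Lemma subset_sum_inversion (R : numDomainType) (T : finType) (F : {set T} -> R) (M : R) :
    (forall B : {set T}, `|\sum_(D : {set T} | D \subset B) F D| <= M) ->
  forall A : {set T}, `|F A| <= 2 ^+ #|A| * M.
Proof.
move=> FM.
pose G (A B : {set T}) := \sum_(D : {set T} | (A \subset D) && (D \subset B)) F D.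
suff GM m (A B : {set T}) : #|A| = m -> A \subset B -> `|G A B| <= 2 ^+ m * M.
  move=> A; have := GM _ A A erefl (fintype.subxx _); rewrite /G (big_pred1 A) // => D.
  by rewrite /= eq_sym finset.eqEsubset.
elim: m A B => [|m IH] A B => [/cards0_eq-> _ | cardA AB].
  rewrite mul1r; apply: le_trans (FM B); rewrite /G le_eqVlt; apply/orP; left.
  by apply/eqP; congr (`| _ |); apply: eq_bigl => D; rewrite finset.sub0set.
have /card_gt0P[x Ax] : (0 < #|A|)%N by rewrite cardA.
have cardA' : #|A :\ x| = m by move: cardA; rewrite (cardsD1 x) Ax => -[].
have -> : G A B = G (A :\ x) B - G (A :\ x) (B :\ x).
  rewrite /G (bigID [pred D : {set T} | x \in D]) /=.
  rewrite [X in _ = X - _](bigID [pred D : {set T} | x \in D]) /=.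
  have -> : \sum_(D : {set T} | (A :\ x \subset D) && (D \subset B :\ x)) F D =
      \sum_(D : {set T} | (A :\ x \subset D) && (D \subset B) && (x \notin D)) F D.
    by apply: eq_bigl => D; rewrite finset.subsetD1 andbA.
  rewrite addrK [X in _ + X]big1 ?addr0 => [|D /andP[/andP[AD _] /negP[]]]; last first.
    exact: (fintype.subsetP AD).
  apply: eq_bigl => D; case Dx: (x \in D); rewrite ?andbT ?andbF //.
  by rewrite -[in LHS](finset.setD1K Ax) finset.subUset finset.sub1set Dx.
apply: le_trans (ler_normB _ _) _; rewrite exprS -mulrA mulr2n mulrDl mul1r.
apply: lerD; apply: IH => //.
  by apply: fintype.subset_trans AB; apply: finset.subD1set.
by apply: finset.setSD.
Qed.

(** For containment in place of equality, the error is the number of words that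
    are lost because two of their rotations coincide, whatever the set. *)
Lemma beta_cyc_error (R : numDomainType) n (I : {set 'I_n.-1}) : (0 < n)%N ->
  `|n%:R * (beta_cyc I)%:R - (beta I)%:R| <= (2 ^ n * (n * n ^ n./2))%:R :> R.
Proof.
move=> n_gt0; pose M := (n * n ^ n./2)%N.
pose F (D : {set 'I_n.-1}) : R := n%:R * (beta_cyc D)%:R - (beta D)%:R.
have FM (B : {set 'I_n.-1}) : `|\sum_(D : {set 'I_n.-1} | D \subset B) F D| <= M%:R.
  have bh := @block_index_mono n B.
  rewrite /F sumrB -mulr_sumr -!natr_sum.
  have -> : (\sum_(D : {set 'I_n.-1} | D \subset B) beta D)%N = #|words (block_index B)|.
    rewrite -card_block_increasing //.
    transitivity #|[set s : 'S_n | xpredT s & descent_set s \subset B]|.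
      rewrite count_by_descent_set; apply: eq_bigr => D _.
      by apply: eq_card => s; rewrite !inE.
    by apply: eq_card => s; rewrite inE descent_subset_blocks.
  have -> : (n%:R * (\sum_(D : {set 'I_n.-1} | D \subset B) beta_cyc D)%:R : R) =
            #|pointed_cycles (block_index B)|%:R.
    rewrite -natrM card_conj_rotation //; congr (n * _)%:R.
    rewrite -count_by_descent_set; apply: eq_card => s.
    by rewrite finset.in_set [RHS]finset.in_set -descent_subset_blocks andbC.
  rewrite distrC ger0_norm ?subr_ge0 ?ler_nat ?card_pointed_cycles_le //.
  by rewrite lerBlDl -natrD ler_nat card_words_le.
apply: le_trans (subset_sum_inversion FM I) _.
rewrite -natrX -natrM ler_nat leq_mul2r leq_pexp2l ?orbT //.
by apply: leq_trans (max_card _) _; rewrite card_ord leq_pred.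
Qed.

(** * The number of permutations with a periodic descent set *)

Local Close Scope ring_scope.

(** Group the permutations by the word of levels [h \o s]. There are [K ^ n]
    words, and every nonempty group is, up to multiplication on the left by a fixed
    permutation, contained in the group of the sorted word. *)
Lemma fact_le_layered n K (h : 'I_n -> 'I_K) :
  n`! <= K ^ n * #|[set s : 'S_n | [forall i : 'I_n, forall j : 'I_n,
                                      (i <= j) ==> (h (s i) <= h (s j))]]|.
Proof.
set S := [set s : 'S_n | _].
have monoP (s : 'S_n) : reflect {homo h \o s : i j / i <= j} (s \in S).
  rewrite inE; apply: (iffP forallP) => [mono i j ij | mono i].
    by have /forallP/(_ j)/implyP := mono i; apply.
  by apply/forallP => j; apply/implyP; apply: mono.
have [s0 Ss0] : exists s0, s0 \in S.
  pose key (i : 'I_n) := h i * n + i.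
  have key_inj : injective key by exact: label_position_inj.
  have [rho rhoE] := exists_rank_perm key_inj.
  exists (rho^-1)%g; apply/monoP => i j /=; rewrite leq_eqVlt => /orP[/eqP/val_inj->//|].
  move=> ij; have := rhoE (rho^-1 i)%g (rho^-1 j)%g.
  by rewrite !permKV ij digits_ltE // => /esym/orP[/ltnW|/andP[/eqP->]].
pose fibre (w : {ffun 'I_n -> 'I_K}) := [set s : 'S_n | word h s == w].
have fibre_small w : #|fibre w| <= #|S|.
  have [->|[s1]] := set_0Vmem (fibre w); first by rewrite cards0.
  rewrite inE => /eqP w_def.
  rewrite -(card_imset _ (mulgI (s0 * s1^-1)%g)).
  apply/subset_leq_card/fintype.subsetP => _ /imsetP[s + ->].
  rewrite inE -w_def => /eqP/ffunP eq_w; apply/monoP => i j ij /=.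
  have eq_h x : h ((s0 * s1^-1 * s)%g x) = h (s0 x).
    by have := eq_w (s1^-1%g (s0 x)); rewrite !ffunE !permM permKV.
  by rewrite !eq_h; apply: (monoP _ Ss0).
have -> : n`! = \sum_(w : {ffun 'I_n -> 'I_K}) #|fibre w|.
  rewrite -card_Sn -sum1_card (partition_big (word h) predT) //=.
  by apply: eq_bigr => w _; rewrite -sum1_card; apply: eq_bigl => s; rewrite !inE.
apply: leq_trans (leq_sum _ (fun w _ => fibre_small w)) _.
by rewrite sum_nat_const card_ffun !card_ord.
Qed.

(** The inverse of a permutation that lists the positions level by level gives
    larger values to higher levels. *)
Lemma fact_le_beta n K (I : {set 'I_n.-1}) (h : 'I_n -> 'I_K) :
    (forall (a : 'I_n.-1) (i j : 'I_n), i = a :> nat -> j = a.+1 :> nat ->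
       if a \in I then h j < h i else h i < h j) ->
  n`! <= K ^ n * beta I.
Proof.
move=> hI; apply: leq_trans (fact_le_layered h) _; rewrite leq_mul2l; apply/orP; right.
rewrite /beta -[X in X <= _](card_imset _ (@invg_inj _)).
apply/subset_leq_card/fintype.subsetP => _ /imsetP[s + ->]; rewrite !inE => /forallP mono.
have sV (x y : 'I_n) : h x < h y -> (s^-1 x < s^-1 y)%g.
  move=> lt_h; rewrite ltnNge; apply/negP => le_yx.
  have /forallP/(_ (s^-1 x)%g)/implyP/(_ le_yx) := mono (s^-1 y)%g.
  by rewrite !permKV leqNgt lt_h.
apply/eqP/setP => a; have [i [j [ia ja]]] := descent_position a.
rewrite (mem_descent_set _ ia ja); have := hI a i j ia ja.
by case: ifP => _ /sV // lt_s; rewrite ltnNge ltnW.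
Qed.

Definition run_length (k : nat) (Q : pred nat) (p : nat) : nat :=
  find (predC Q) (iota p k).

Lemma run_length_le k Q p : run_length k Q p <= k.
Proof. by rewrite -[X in _ <= X](size_iota p k) find_size. Qed.

Lemma run_length_lt k (Q : pred nat) p :
  (exists2 j, j < k & ~~ Q (p + j)) -> run_length k Q p < k.
Proof.
move=> [j lt_j nQ]; rewrite -[X in _ < X](size_iota p k) -has_find.
by apply/hasP; exists (p + j) => //; rewrite mem_iota leq_addr ltn_add2l.
Qed.

Lemma run_length0 k (Q : pred nat) p : ~~ Q p -> run_length k Q p = 0.
Proof. by case: k => // k nQ; rewrite /run_length /= nQ. Qed.

(** The window of [k] places moves along with [p]; the counts still correspond,
    because the run ends inside both windows. *)
Lemma run_lengthS k (Q : pred nat) p : (exists2 j, j < k & ~~ Q (p + j)) ->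
  Q p -> run_length k Q p = (run_length k Q p.+1).+1.
Proof.
move=> [j lt_j nQ] Qp; case: k lt_j => // k lt_j.
rewrite /run_length -{2}addn1 iotaD find_cat /= Qp /=.
suff -> : has (predC Q) (iota p.+1 k) by [].
apply/hasP; exists (p + j) => //; rewrite mem_iota.
case: j lt_j nQ => [|j] lt_j nQ; first by rewrite addn0 Qp in nQ.
by rewrite addnS addSn !ltnS leq_addr ltn_add2l.
Qed.

(** The level is [k] plus the number of descents in a row that start at [p] minus
    the number of ascents in a row that start at [p]. One of the two numbers
    vanishes at [p], the other one decreases by one when passing to [p + 1]. *)
Lemma level_function k (P : pred nat) :
    (forall p, exists2 j, j < k & P (p + j)) ->
    (forall p, exists2 j, j < k & ~~ P (p + j)) ->
  exists2 h : nat -> nat, forall p, h p < k.*2 &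
    forall p, if P p then h p.+1 < h p else h p < h p.+1.
Proof.
move=> P_in P_out.
pose down p := run_length k P p; pose up p := run_length k (predC P) p.
have P_in' p : exists2 j, j < k & ~~ predC P (p + j).
  by have [j lt_j Pj] := P_in p; exists j; rewrite //= negbK.
exists (fun p => k + down p - up p) => p.
  by have := run_length_lt (P_out p); rewrite -/(down p) -addnn; lia.
have := run_length_le k (predC P) p; have := run_length_le k (predC P) p.+1.
case: ifPn => Pp.
  have := run_lengthS (P_out p) Pp; have : up p = 0 by apply: run_length0; rewrite /= negbK.
  by rewrite /up /down; lia.
have := run_lengthS (P_in' p) Pp; have : down p = 0 by apply: run_length0.
by rewrite /up /down; lia.
Qed.

Lemma periodic_shift l (I : set nat) : ell_periodic l I ->
  forall m i, 0 < i -> (I i <-> I (i + m * l)).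
Proof.
move=> per m; elim: m => [|m IH] i i_gt0; first by rewrite mul0n addn0.
rewrite IH // (per (i + m * l)); last by rewrite addn_gt0 i_gt0.
by rewrite -addnA -mulSnr.
Qed.

Lemma periodic_window l (I : set nat) : 0 < l -> ell_periodic l I ->
  forall i p, 0 < i -> exists2 j, j < l & (I i <-> I (p + j).+1).
Proof.
move=> l_gt0 per i p i_gt0; pose y := i + p.+1 * l.
exists ((y - p.+1) %% l); first by rewrite ltn_mod.
rewrite (periodic_shift per p.+1) // -/y -addSn.
rewrite (periodic_shift per ((y - p.+1) %/ l) (_ : 0 < p.+1 + _)) //.
suff -> : p.+1 + (y - p.+1) %% l + (y - p.+1) %/ l * l = y by [].
rewrite -addnA [_ %% _ + _]addnC -divn_eq subnKC //.
by rewrite /y (leq_trans _ (leq_addl _ _)) // leq_pmulr.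
Qed.

Lemma fact_le_beta_periodic k n (A : {set 'I_n.-1}) : A \in periodic_traces k n ->
  n`! <= k.*2 ^ n * beta A.
Proof.
rewrite inE => /asboolP[I [I_ne I_proper [l [/andP[l_gt0 lk] per]] ->]].
pose P : pred nat := fun p => `[< I p.+1 >].
have [||h h_lt hP] := @level_function k P.
- move=> p; have [_ /nonsubset[i [Ii _]]] := I_ne.
  have i_gt0 : 0 < i by have [sub _] := I_proper; apply: sub.
  have [j lt_j per_j] := periodic_window l_gt0 per p i_gt0.
  by exists j; [apply: leq_trans lk | apply/asboolP/per_j].
- move=> p; have [_ /nonsubset[i [i_gt0 nIi]]] := I_proper.
  have [j lt_j per_j] := periodic_window l_gt0 per p i_gt0.
  by exists j; [apply: leq_trans lk | apply/asboolPn => /per_j].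
apply: (@fact_le_beta _ _ _ (fun i => Ordinal (h_lt i))) => a i j /= -> ->.
by have := hP a; rewrite inE.
Qed.

(** * The estimate *)

(** This follows from [n ^ n * n`! <= (2 n)`!] and from the bound [4 ^ n] for the
    central binomial coefficient. *)
Lemma expn_self_le_fact n : n ^ n <= 4 ^ n * n`!.
Proof.
have grow m : n ^ m * n`! <= (n + m)`!.
  elim: m => [|m IH]; first by rewrite mul1n addn0.
  rewrite expnS addnS factS -mulnA leq_mul //.
  by rewrite -addnS leq_addr.
have binom : 'C(n + n, n) <= 4 ^ n.
  rewrite -[4]/(2 ^ 2) -expnM mul2n -addnn -[2]/(1 + 1) expnDn.
  have lt_n : n < (n + n).+1 by rewrite ltnS leq_addr.
  by rewrite (bigD1 (Ordinal lt_n)) //= !exp1n !muln1 leq_addr.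
rewrite -(leq_pmul2r (fact_gt0 n)); apply: leq_trans (grow n) _.
rewrite -(bin_fact (leq_addr n n)) addnK -mulnA leq_mul2r binom orbT //.
Qed.

(** With [p] the upper half of [n], the constants to the power [n] amount to
    [(16 K) ^ n <= ((16 K) ^ 2) ^ p <= (16 K) ^ 2 * n ^ (p - 1)]. The
    factors [n], [n ^ (n / 2)] and [n ^ (p - 1)] make up [n ^ n], and the other
    factor [n] is absorbed by [n <= 2 ^ n]. *)
Lemma error_le_beta n K B : 0 < n -> 0 < K -> (16 * K) ^ 2 <= n -> n`! <= K ^ n * B ->
  n * (2 ^ n * (n * n ^ n./2)) <= (16 * K) ^ 2 * B.
Proof.
move=> n_gt0 K_gt0 n_large factB; set C := 16 * K.
rewrite -(leq_pmul2r (_ : 0 < (4 * K) ^ n)); last by rewrite expn_gt0 muln_gt0 K_gt0.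
have selfB : n ^ n <= (4 * K) ^ n * B.
  by apply: leq_trans (expn_self_le_fact n) _; rewrite expnMn -mulnA leq_mul2l factB orbT.
apply: leq_trans (_ : C ^ 2 * n ^ n <= _); last first.
  by rewrite -mulnA leq_mul2l [B * _]mulnC selfB orbT.
have powC : C ^ n <= C ^ 2 * n ^ (uphalf n).-1.
  have up_gt0 : 0 < uphalf n by rewrite uphalf_gt0.
  apply: leq_trans (_ : (C ^ 2) ^ uphalf n <= _).
    rewrite -expnM leq_pexp2l ?muln_gt0 //.
    by rewrite mul2n uphalfK leq_addl.
  rewrite -{1}(prednK up_gt0) expnS leq_mul2l; apply/orP; right.
  by case: (uphalf n).-1 => // q; rewrite leq_exp2r.
have -> : n ^ n = n * n ^ n./2 * n ^ (uphalf n).-1.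
  rewrite -expnS -expnD addSn -addnS prednK ?uphalf_gt0 //.
  by rewrite uphalf_half addnCA addnn odd_double_half.
have -> : n * (2 ^ n * (n * n ^ n./2)) * (4 * K) ^ n =
          n * n ^ n./2 * (n * 2 ^ n * (4 * K) ^ n) by lia.
have -> : C ^ 2 * (n * n ^ n./2 * n ^ (uphalf n).-1) =
          n * n ^ n./2 * (C ^ 2 * n ^ (uphalf n).-1) by lia.
rewrite leq_mul2l; apply/orP; right; apply: leq_trans powC.
have -> : C = 2 * 2 * (4 * K) by rewrite /C; lia.
rewrite (expnMn (2 * 2)) (expnMn 2) leq_mul2r leq_mul2r.
by rewrite ltnW ?orbT // ltn_expl.
Qed.

Lemma max_deviation_le (R : realType) k n : (0 < k)%N -> (0 < n)%N ->
  ((16 * k.*2) ^ 2 <= n)%N ->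
  (max_deviation R k n <= ((16 * k.*2) ^ 2)%:R / n%:R)%R.
Proof.
move=> k_gt0 n_gt0 n_large; have C_ge0 : (0 <= ((16 * k.*2) ^ 2)%:R / n%:R :> R)%R.
  by rewrite divr_ge0 ?ler0n.
apply: bigmax_le => // A /fact_le_beta_periodic factA.
have K_gt0 : 0 < k.*2 by rewrite double_gt0.
have beta_gt0 : 0 < beta A.
  by move: factA; case: (beta A) => //; rewrite muln0 leqNgt fact_gt0.
have betaR : (0 < (beta A)%:R :> R)%R by rewrite ltr0n.
have nR : (0 < n%:R :> R)%R by rewrite ltr0n.
rewrite -[X in (_ - X)%R](divff (lt0r_neq0 betaR)) -mulrBl normrM normfV.
rewrite (gtr0_norm betaR) ler_pdivrMr // mulrAC ler_pdivlMr //.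
rewrite mulrC; apply: le_trans (ler_wpM2l (ltW nR) (beta_cyc_error R A n_gt0)) _.
by rewrite -!natrM ler_nat (error_le_beta n_gt0 K_gt0).
Qed.

Local Open Scope classical_set_scope.
Local Open Scope ring_scope.

Theorem theorem5p7 (R : realType) (k : nat) (hk : (2 <= k)%N) :
  (fun n : nat => max_deviation R k n) @ \oo --> (0 : R).
Proof.
have k_gt0 : (0 < k)%N by apply: leq_trans hk.
pose C := ((16 * k.*2) ^ 2)%N.
apply/cvgrPdist_le => e e_gt0; near=> n.
have n_gt0 : (0 < n)%N by near: n; exists 1%N.
have n_large : (C <= n)%N by near: n; exists C.
have dev_ge0 : 0 <= max_deviation R k n by exact: bigmax_ge_id.
rewrite sub0r normrN ger0_norm //; apply: le_trans (max_deviation_le R k_gt0 n_gt0 n_large) _.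
rewrite ler_pdivrMr ?ltr0n // mulrC -ler_pdivrMr //.
by near: n; apply: nbhs_infty_ger.
Unshelve. all: by end_near.
Qed.
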